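(* Let $V$ be a finite set of variables, let $g$ be a term with $\hat g\subseteq V$, and let $Call=(cl_1,sh_1)$ and $Prime=(cl_2,sh_2)$ be elements of $SH^{w}$ such that every set occurring in $cl_1\cup sh_1$ is a subset of $V$, every set occurring in $cl_2\cup sh_2$ is a subset of $\hat g$, and $Prime$ is normalized. Let $extend^s(Call,g,Prime)=(cl',sh')$. Then \[ \downarrow\!\!(cl')\cup sh' \;\supseteq\; extend\big(\downarrow\!\!(cl_1)\cup sh_1,\ g,\ \downarrow\!\!(cl_2)\cup sh_2\big). \]
   Context: For a set $S$, $\wp^0(S)$ denotes the set of nonempty subsets of $S$. Variables of interest form a finite set $V$; for a term (or atom) $t$, $\hat t$ denotes its set of variables. A sharing group is a nonempty subset of $V$; a sharing set is a set of sharing groups; $SH$ is the set of all sharing sets. A clique is a nonempty subset $C\subseteq V$, standing for all groups in $\downarrow C:=\wp^0(C)$; a clique set $cl$ is a set of cliques, and $\downarrow\!\!(cl):=\bigcup_{C\in cl}\wp^0(C)$. The Clique-Sharing domain $SH^{w}$ consists of pairs $(cl,sh)$ of a clique set and a sharing set; the pair represents the sharing set $\downarrow\!\!(cl)\cup sh$. Operations on a set $s$ of sets of variables (sharing set or clique set): $s_1\uplus s_2=\{A\cup B\mid A\in s_1,B\in s_2\}$ (binary union); $s^*$ is the closure of $s$ under (nonempty finite) unions (star union); for a term $t$, $s_t=\{A\in s\mid A\cap\hat t\neq\emptyset\}$ and $\overline{s_t}=s\setminus s_t$; for a variable $x$, $s_x=\{A\in s\mid x\in A\}$. For $S\subseteq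 V$ and a clique set $cl$, $\overline{rel}(S,cl)=\{C\setminus S\mid C\in cl\}\setminus\{\emptyset\}$. A pair $(cl,sh)\in SH^w$ is normalized if whenever $s\subseteq \downarrow\!\!(cl)\cup sh$ with $s=\wp^0(c)$ for some set $c$, then $s\cap sh=\emptyset$. $normalize$ denotes a function mapping a pair $(cl,sh)$ to a normalized pair $(cl'',sh'')$ with $\downarrow\!\!(cl'')\cup sh''=\downarrow\!\!(cl)\cup sh$. Classical extend on sharing sets: $extend(Call,g,Prime)=\overline{Call_g}\cup\{s\mid s\in Call_g^*,\ (s\cap\hat g)\in Prime\}$. Clique extend: given $Call=(cl_1,sh_1)$, $Prime=(cl_2,sh_2)$ (with $Prime$ normalized), let $(cl^\circ,sh^\circ)=normalize\big(({cl_1}_g)^*\cup(({cl_1}_g)^*\uplus({sh_1}_g)^* ),\ ({sh_1}_g)^*\big)$ and define $extsh(sh_1,g,sh_2)=\overline{{sh_1}_g}\cup\{s\mid s\in sh^\circ,\ (s\cap\hat g)\in sh_2\}$; $extcl(cl_1,g,cl_2)=\overline{rel}(\hat g,cl_1)\cup\{(s'\cap s)\cup(s'\setminus\hat g)\mid s'\in cl^\circ,\ s\in cl_2\}$; $clsh(cl^\circ,g,sh_2)=\{s\mid s\subseteq c \text{ for some } c\in cl^\circ,\ (s\cap\hat g)\in sh_2\}$; $shcl(sh^\circ,g,cl_2)=\{s\mid s\in sh^\circ,\ (s\cap\hat g)\subseteq c\text{ for some } c\in cl_2\}$. Then $extend^s((cl_1,sh_1),g,(cl_2,sh_2))=\big(extcl(cl_1,g,cl_2),\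 extsh(sh_1,g,sh_2)\cup clsh(cl^\circ,g,sh_2)\cup shcl(sh^\circ,g,cl_2)\big)$. *)

(* Defs.v *)
From mathcomp Require Import all_boot.

Set Implicit Arguments.
Unset Strict Implicit.
Unset Printing Implicit Defensive.

(* Terms and atoms over the variables [V]: a variable, or a function or
   predicate symbol of [F] applied to a list of arguments (arities are not
   constrained). *)
Inductive term (F : Type) (V : finType) : Type :=
| TVar of V
| TApp of F & seq (term F V).

Fixpoint vars (F : Type) (V : finType) (t : term F V) : {set V} :=
  match t with
  | TVar x => [set x]
  | TApp _ ts => foldr (fun u A => vars u :|: A) set0 ts
  end.

Definition pow0 (T : finType) (S : {set T}) : {set {set T}} :=
  powerset S :\ set0.

Section CliqueSharing.

Variables (F : Type) (V : finType).

Implicit Types (s sh sho cl clo : {set {set V}}) (g t : term F V).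

Definition down cl : {set {set V}} := \bigcup_(C in cl) pow0 C.

Definition bunion s1 s2 : {set {set V}} := [set A :|: B | A in s1, B in s2].

(* All unions of nonempty subfamilies of [s]. *)
Definition star s : {set {set V}} := [set cover B | B in pow0 s].

Definition relevant s t : {set {set V}} := [set A in s | A :&: vars t != set0].

Definition irrelevant s t : {set {set V}} := s :\: relevant s t.

Definition relbar (S : {set V}) cl : {set {set V}} :=
  [set C :\: S | C in cl] :\ set0.

(* A raw pair (cl, sh); membership in the domain SH^w, i.e. nonemptiness of
   all cliques and sharing groups, is the predicate [in_SHw]. *)
Definition clsharing : Type := ({set {set V}} * {set {set V}})%type.

Implicit Type p : clsharing.

Definition in_SHw p : Prop := set0 \notin p.1 /\ set0 \notin p.2.

Definition represented p : {set {set V}} := down p.1 :|: p.2.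

Definition normalized p : Prop :=
  forall s, s \subset represented p -> (exists c : {set V}, s = pow0 c) ->
    s :&: p.2 = set0.

Definition is_normalize (normalize : clsharing -> clsharing) : Prop :=
  forall p, in_SHw p ->
    [/\ in_SHw (normalize p), normalized (normalize p)
      & represented (normalize p) = represented p].

Definition extend (call : {set {set V}}) g (prime : {set {set V}}) :
    {set {set V}} :=
  irrelevant call g
    :|: [set s in star (relevant call g) | s :&: vars g \in prime].

(* The pair (cl°, sh°). *)
Definition extend_circ (normalize : clsharing -> clsharing) cl1 sh1 g :
    clsharing :=
  normalize
    (star (relevant cl1 g)
       :|: bunion (star (relevant cl1 g)) (star (relevant sh1 g)),
     star (relevant sh1 g)).

(* In [extsh] and [extcl] the component of (cl°, sh°) used is passed
   explicitly as the last argument. *)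
Definition extsh sh1 g sh2 sho : {set {set V}} :=
  irrelevant sh1 g :|: [set s in sho | s :&: vars g \in sh2].

Definition extcl cl1 g cl2 clo : {set {set V}} :=
  relbar (vars g) cl1
    :|: [set (s' :&: s) :|: (s' :\: vars g) | s' in clo, s in cl2].

Definition clsh clo g sh2 : {set {set V}} :=
  [set s : {set V} | [exists c in clo, s \subset c] & s :&: vars g \in sh2].

Definition shcl sho g cl2 : {set {set V}} :=
  [set s in sho | [exists c in cl2, s :&: vars g \subset c]].

Definition extends (normalize : clsharing -> clsharing)
    (Call : clsharing) g (Prime : clsharing) : clsharing :=
  let: (cl1, sh1) := Call in
  let: (cl2, sh2) := Prime in
  let: (clo, sho) := extend_circ normalize cl1 sh1 g in
  (extcl cl1 g cl2 clo,
   extsh sh1 g sh2 sho :|: clsh clo g sh2 :|: shcl sho g cl2).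

End CliqueSharing.

(* Main.v *)
(** A member of the classical extension that meets [g] is a union of groups
    below relevant cliques of [cl1] and of relevant groups of [sh1].  If no
    clique contributes, it lies in the star closure of the relevant part of
    [sh1]; otherwise it lies below the union of all relevant cliques, possibly
    joined with such a star element.  Hence it is represented by the pair fed to
    [normalize], so by [(cl°, sh°)], and the four combinations (clique or
    sharing group on the call side, clique or sharing group on the prime side)
    are those handled by [extcl], [clsh], [shcl] and [extsh]. *)

Require Import Defs.
From mathcomp Require Import all_boot.

Set Implicit Arguments.
Unset Strict Implicit.
Unset Printing Implicit Defensive.

Section CliqueSharingTheory.

Variables (F : Type) (V : finType).

Implicit Types (A C D : {set V}) (s cl sh : {set {set V}}) (g : term F V).

Lemma in_pow0 (T : finType) (A B : {set T}) :
  (A \in pow0 B) = (A != set0) && (A \subset B).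
Proof. by rewrite !inE. Qed.

Lemma downP cl A :
  reflect (A != set0 /\ exists2 C, C \in cl & A \subset C) (A \in down cl).
Proof.
apply: (iffP bigcupP) => [[C clC]|[A0 [C clC sAC]]].
  by rewrite in_pow0 => /andP[-> sAC]; split=> //; exists C.
by exists C; rewrite // in_pow0 A0.
Qed.

Lemma starP s A :
  reflect (exists2 B : {set {set V}}, B != set0 /\ B \subset s & A = cover B)
          (A \in star s).
Proof.
apply: (iffP imsetP) => -[B sB ->]; exists B => //.
  by apply/andP; rewrite -in_pow0.
by rewrite in_pow0; apply/andP.
Qed.

Lemma cover_star (B s : {set {set V}}) :
  B != set0 -> B \subset s -> cover B \in star s.
Proof. by move=> B0 sB; apply/starP; exists B. Qed.

Lemma mem_relevant s g A :
  (A \in relevant s g) = (A \in s) && (A :&: vars g != set0).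
Proof. by rewrite inE. Qed.

Lemma meet_neq0S A C D : A \subset C -> A :&: D != set0 -> C :&: D != set0.
Proof. by move=> sAC; apply: subset_neq0; rewrite setSI. Qed.

Lemma star_relevant_meet s g A :
  A \in star (relevant s g) -> A :&: vars g != set0.
Proof.
case/starP=> B [/set0Pn[C BC] sB] ->.
have := subsetP sB C BC; rewrite mem_relevant => /andP[_].
by apply: meet_neq0S; apply: bigcup_sup.
Qed.

Lemma set0_notin_star_relevant s g : set0 \notin star (relevant s g).
Proof. by apply/negP => /star_relevant_meet; rewrite set0I eqxx. Qed.

(** The argument that [extend_circ] passes to [normalize], named so that it can be studied before
    normalization. *)
Definition circ_input cl sh g : clsharing V :=
  (star (relevant cl g)
     :|: bunion (star (relevant cl g)) (star (relevant sh g)),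
   star (relevant sh g)).

(** Every member contains a star element of relevant sets, which meets [vars g]. This is the side
    condition under which [is_normalize] applies. *)
Lemma circ_input_SHw cl sh g : in_SHw (circ_input cl sh g).
Proof.
split; rewrite /= ?inE ?negb_or ?set0_notin_star_relevant //=.
apply/negP => /imset2P[A B clA _ /esym/eqP]; rewrite setU_eq0 => /andP[A0 _].
by rewrite (eqP A0) (negPf (set0_notin_star_relevant _ _)) in clA.
Qed.

Lemma star_relevant_represented cl sh g A :
  A \in star (relevant (represented (cl, sh)) g) ->
  A \in represented (circ_input cl sh g).
Proof.
move=> Astar; have Ag := star_relevant_meet Astar.
have A0 : A != set0 by apply: subset_neq0 (subsetIl _ _) Ag.
case/starP: Astar => B [B0 sB] defA.
(* A group lying both in [sh] and below a clique is counted on the sharing side, so only groups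
   outside [sh] need a clique above them. *)
set Bsh := B :&: sh; rewrite in_setU.
have sBsh : Bsh \subset relevant sh g.
  apply/subsetP=> C /setIP[BC shC]; rewrite mem_relevant shC /=.
  by have := subsetP sB C BC; rewrite mem_relevant => /andP[].
have [sBS | /subsetPn[C0 BC0 nshC0]] := boolP (B \subset sh).
  by rewrite defA orbC /= cover_star //; rewrite /Bsh (setIidPl sBS) in sBsh.
have clique_above C : C \in B -> C \notin sh ->
    exists2 D, D \in relevant cl g & C \subset D.
  move=> BC nshC; have := subsetP sB C BC.
  rewrite mem_relevant in_setU (negPf nshC) orbF /= => /andP[].
  case/downP=> _ [D clD sCD] Cg; exists D => //.
  by rewrite mem_relevant clD (meet_neq0S sCD).
have relcl0 : relevant cl g != set0.
  by have [D rD _] := clique_above _ BC0 nshC0; apply/set0Pn; exists D.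
have starcl : cover (relevant cl g) \in star (relevant cl g).
  exact: cover_star.
(* Groups from [sh] are kept; every other one is enlarged to a relevant clique above it. *)
have sA : A \subset cover (relevant cl g) :|: cover Bsh.
  rewrite defA; apply/bigcupsP=> C BC; case: (boolP (C \in sh)) => shC.
    by rewrite subsetU //; apply/orP; right; rewrite bigcup_sup // inE BC.
  have [D rD sCD] := clique_above _ BC shC.
  by rewrite subsetU // (subset_trans sCD) // bigcup_sup.
apply/orP; left; apply/downP; split=> //.
(* [star] uses nonempty subfamilies only, so the [bunion] component is available just when [Bsh] is
   nonempty. *)
have [Bsh0 | Bsh0] := eqVneq Bsh set0.
  exists (cover (relevant cl g)); first by rewrite inE starcl.
  by rewrite Bsh0 /cover big_set0 setU0 in sA.
exists (cover (relevant cl g) :|: cover Bsh) => //.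
by rewrite inE imset2_f ?orbT // cover_star.
Qed.

(** A relevant clique may also cover groups that avoid [vars g]; such a group survives removing
    [vars g] from the clique, which therefore stays nonempty. *)
Lemma irrelevant_represented cl sh g A :
  A \in irrelevant (represented (cl, sh)) g ->
  (A \in down (relbar (vars g) cl)) || (A \in irrelevant sh g).
Proof.
case/setDP=> repA; rewrite mem_relevant repA /= negbK => /eqP Ag0.
case/setUP: repA => /= [/downP[A0 [C clC sAC]] | shA]; apply/orP; last first.
  by right; rewrite in_setD mem_relevant shA Ag0 eqxx.
have sACg : A \subset C :\: vars g by rewrite subsetD sAC -setI_eq0 Ag0 eqxx.
left; apply/downP; split=> //; exists (C :\: vars g) => //.
by rewrite in_setD1 (subset_neq0 sACg A0); apply/imsetP; exists C.
Qed.

End CliqueSharingTheory.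

Theorem theorem1 (F : Type) (V : finType)
    (normalize : clsharing V -> clsharing V)
    (Hnormalize : is_normalize normalize)
    (g : term F V)
    (cl1 sh1 cl2 sh2 : {set {set V}})
    (HCall : in_SHw (cl1, sh1))
    (HPrime : in_SHw (cl2, sh2))
    (HPrime_vars : forall A : {set V}, A \in cl2 :|: sh2 -> A \subset vars g)
    (HPrime_norm : normalized (cl2, sh2))
    (cl' sh' : {set {set V}})
    (Hext : extends normalize (cl1, sh1) g (cl2, sh2) = (cl', sh')) :
  extend (down cl1 :|: sh1) g (down cl2 :|: sh2) \subset down cl' :|: sh'.
Proof.
have [_ _ rep_circ] := Hnormalize _ (circ_input_SHw cl1 sh1 g).
move: Hext rep_circ; rewrite /extends /extend_circ -/(circ_input cl1 sh1 g).
case: (normalize _) => clo sho [<- <-] rep_circ.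
apply/subsetP=> A /setUP[/irrelevant_represented | ].
  case/orP=> [/downP[A0 [C relC sAC]]|irrA]; last by rewrite !in_setU irrA !orbT.
  rewrite in_setU; apply/orP; left; apply/downP; split=> //.
  by exists C; rewrite // in_setU relC.
rewrite inE => /andP[Astar Aprime].
have Ag := star_relevant_meet Astar.
have A0 : A != set0 by apply: subset_neq0 (subsetIl _ _) Ag.
have := star_relevant_represented Astar; rewrite -rep_circ.
case/setUP=> [/downP[_ [C' /= cloC' sAC']] | /= shoA];
  case/setUP: Aprime => [/downP[_ [C cl2C sAC]] | sh2A].
- rewrite in_setU; apply/orP; left; apply/downP; split=> //.
  (* The part of [A] inside [vars g] lies below both [C'] and [C], the rest below [C'] outside
     [vars g]. *)
  exists ((C' :&: C) :|: (C' :\: vars g)).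
    by rewrite in_setU; apply/orP; right; apply/imset2P; exists C' C.
  rewrite -(setID A (vars g)) setUSS ?setSD // subsetI sAC andbT.
  by rewrite (subset_trans (subsetIl _ _)).
- have clshA : A \in clsh clo g sh2.
    by rewrite inE sh2A andbT; apply/existsP; exists C'; rewrite cloC'.
  by rewrite !in_setU clshA !orbT.
- have shclA : A \in shcl sho g cl2.
    by rewrite inE shoA; apply/existsP; exists C; rewrite cl2C.
  by rewrite !in_setU shclA !orbT.
- by rewrite !in_setU [A \in [set _ in sho | _]]inE shoA sh2A !orbT.
Qed.
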